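(* Let $A\in\mathbb{C}^{n\times n}$ have index $k$, let $m$ be a positive integer, and let $D\in\mathbb{C}^{q\times n}$. If $\mathcal{N}(D)\supseteq\mathcal{N}((A^k)^*A^{m+1})$, then the restricted matrix equation in $X\in\mathbb{C}^{q\times n}$ $$XA=D,\qquad \mathcal{N}(X)\supseteq\mathcal{N}((A^k)^*A^{m+1}A^\dagger)$$ has the unique solution $X=DA^{\mathrm{w}_m,\dagger}$.
   Context: $r(\cdot)$, $\mathcal{N}(\cdot)$, $(\cdot)^*$ denote rank, null space and conjugate transpose; $A^\dagger$ is the Moore-Penrose inverse and $A^D$ the Drazin inverse. The index of $A\in\mathbb{C}^{n\times n}$ is the smallest nonnegative integer $k$ with $r(A^{k+1})=r(A^k)$ (with $A^0=I_n$). For $A$ of index $k$, the core-EP inverse is $A^{\mathrm{cEP}}=A^DA^k(A^k)^\dagger$ and the $m$-weak group inverse is $A^{\mathrm{w}_m}=(A^{\mathrm{cEP}})^{m+1}A^m$. The $m$-weak group MP inverse $A^{\mathrm{w}_m,\dagger}$ is the unique $Y\in\mathbb{C}^{n\times n}$ satisfying $YAY=Y$, $AY=A_1A^\dagger$ and $YA=A^DA_1$, where $A_1=AA^{\mathrm{w}_m}A$. *)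

(* Defs.v *)
From HB Require Import structures.
From mathcomp Require Import all_boot all_order all_algebra.

Set Implicit Arguments.
Unset Strict Implicit.
Unset Printing Implicit Defensive.

Import Order.TTheory GRing.Theory Num.Theory.
Local Open Scope ring_scope.
Local Open Scope sesquilinear_scope.

Section GeneralizedInverses.
Variable C : numClosedFieldType.

(* Column vectors: the null space of v |-> M *m v (kermx is the row kernel). *)
Definition nullspace (p n : nat) (M : 'M[C]_(p, n)) : {pred 'cV[C]_n} :=
  [pred v | M *m v == 0].

Lemma nullspaceE (p n : nat) (M : 'M[C]_(p, n)) (v : 'cV[C]_n) :
  (v \in nullspace M) = (M *m v == 0).
Proof. by []. Qed.

Lemma trmxC_mul (p n q : nat) (A : 'M[C]_(p, n)) (B : 'M[C]_(n, q)) :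
  (A *m B)^t* = B^t* *m A^t*.
Proof. by rewrite trmx_mul map_mxM. Qed.

Definition is_mpinv (p n : nat) (A : 'M[C]_(p, n)) (X : 'M[C]_(n, p)) : bool :=
  [&& A *m X *m A == A, X *m A *m X == X,
      (A *m X)^t* == A *m X & (X *m A)^t* == X *m A].

Lemma row_free_gram_unit (r n : nat) (G : 'M[C]_(r, n)) :
  row_free G -> G *m G^t* \in unitmx.
Proof.
move=> Gfree; rewrite -row_free_unit; apply/inj_row_free => v vGG.
have /eqP : dotmx (v *m G) (v *m G) = 0.
  by rewrite dotmxE trmxC_mul mulmxA -(mulmxA v) vGG mul0mx mxE.
by rewrite (dnorm_eq0 (@dotmx C n)) mulmx_free_eq0 // => /eqP.
Qed.

Lemma mpinv_exists (p n : nat) (A : 'M[C]_(p, n)) : exists X, is_mpinv A X.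
Proof.
have [r [F [G [-> Ffull Gfree]]]] : exists r (F : 'M[C]_(p, r))
    (G : 'M[C]_(r, n)), [/\ A = F *m G, row_full F & row_free G].
  exists (\rank A), (col_base A), (row_base A).
  by rewrite mulmx_base col_base_full row_base_free.
have uG : G *m G^t* \in unitmx by exact: row_free_gram_unit.
have uF : F^t* *m F \in unitmx.
  rewrite -{2}(trmxCK F); apply: row_free_gram_unit.
  by rewrite /row_free mxrank_map mxrank_tr -/(row_full F).
pose P := invmx (G *m G^t*); pose Q := invmx (F^t* *m F).
have Psym : P^t* = P by rewrite /P trmx_inv map_invmx trmxC_mul trmxCK.
have Qsym : Q^t* = Q by rewrite /Q trmx_inv map_invmx trmxC_mul trmxCK.
pose X := G^t* *m P *m Q *m F^t*.
have AX : F *m G *m X = F *m Q *m F^t*.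
  by rewrite /X -!mulmxA (mulmxA G) (mulmxA (G *m _)) mulmxV // mul1mx.
have XA : X *m (F *m G) = G^t* *m P *m G.
  by rewrite /X -!mulmxA (mulmxA (F^t*)) (mulmxA Q) mulVmx // mul1mx.
exists X; apply/and4P; split; apply/eqP.
- by rewrite AX -!mulmxA (mulmxA (F^t*)) (mulmxA Q) mulVmx // mul1mx.
- by rewrite XA /X -!mulmxA (mulmxA G) (mulmxA P) mulVmx // mul1mx.
- by rewrite AX !trmxC_mul trmxCK Qsym mulmxA.
- by rewrite XA !trmxC_mul trmxCK Psym mulmxA.
Qed.

Definition mpinv (p n : nat) (A : 'M[C]_(p, n)) : 'M[C]_(n, p) :=
  xchoose (mpinv_exists A).

Lemma mpinvP (p n : nat) (A : 'M[C]_(p, n)) : is_mpinv A (mpinv A).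
Proof. exact: xchooseP. Qed.

Lemma mpinv_uniq (p n : nat) (A : 'M[C]_(p, n)) (X : 'M[C]_(n, p)) :
  is_mpinv A X -> X = mpinv A.
Proof.
have [/eqP + /eqP + /eqP + /eqP] := and4P (mpinvP A).
set Y := mpinv A => AYA YAY AYs YAs /and4P[/eqP AXA /eqP XAX /eqP AXs /eqP XAs].
have AXY : A *m X = A *m Y.
  by rewrite -AXs -{1}AYA -(mulmxA (A *m Y)) trmxC_mul AXs AYs mulmxA AXA.
have XYA : X *m A = Y *m A.
  by rewrite -XAs -{1}AYA -(mulmxA A) mulmxA trmxC_mul XAs YAs -mulmxA (mulmxA A) AXA.
by rewrite -XAX -mulmxA AXY mulmxA XYA.
Qed.

Section Square.
Variable n : nat.
Implicit Types (A X Y : 'M[C]_n) (k m : nat).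

Lemma mxindex_exists A : exists k, \rank (A ^+ k.+1) == \rank (A ^+ k).
Proof.
suff H j : (exists k, \rank (A ^+ k.+1) == \rank (A ^+ k)) \/
           (\rank (A ^+ j) + j <= n)%N.
  by case: (H n.+1) => // /(leq_trans (leq_addl _ _)); rewrite ltnn.
elim: j => [|j [|IH]]; [by right; rewrite addn0 rank_leq_row | by left | ].
have [|neq] := boolP (\rank (A ^+ j.+1) == \rank (A ^+ j)); first by left; exists j.
right; rewrite addnS -addSn (leq_trans _ IH) // leq_add2r ltn_neqAle neq.
by rewrite exprS -mulmxE mxrankM_maxr.
Qed.

Definition mxindex A : nat := ex_minn (mxindex_exists A).

Definition is_drazin A X : bool :=
  [&& X *m A *m X == X, A *m X == X *m A
    & X *m A ^+ (mxindex A).+1 == A ^+ mxindex A].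

Lemma drazin_exists A : exists X, is_drazin A X.
Proof.
rewrite /is_drazin /mxindex; case: ex_minnP => k /eqP rkE _.
have [U UE] : exists U, A ^+ k = U * A ^+ k.+1.
  apply/submxP; suff : (A ^+ k.+1 == A ^+ k)%MS by case/andP.
  by rewrite -(mxrank_leqif_eq _) ?rkE // exprS -mulmxE submxMl.
have [V VE] : exists V, A ^+ k = A ^+ k.+1 * V.
  suff /submxP[W WE] : ((A ^+ k)^T <= (A ^+ k.+1)^T)%MS.
    by exists W^T; rewrite -mulmxE -[LHS]trmxK WE trmx_mul trmxK.
  suff : ((A ^+ k.+1)^T == (A ^+ k)^T)%MS by case/andP.
  by rewrite -(mxrank_leqif_eq _) ?mxrank_tr ?rkE // exprSr -mulmxE trmx_mul submxMl.
have UjE j : U ^+ j * A ^+ (k + j) = A ^+ k.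
  elim: j => [|j IH]; first by rewrite mul1r addn0.
  by rewrite exprSr addnS -addSn exprD mulrA -(mulrA (U ^+ j)) -UE -mulrA -exprD.
have VjE j : A ^+ (k + j) * V ^+ j = A ^+ k.
  elim: j => [|j IH]; first by rewrite mulr1 addn0.
  rewrite addnS -addSn addnC exprD (exprS V) mulrA -(mulrA (A ^+ j)) -VE -exprD.
  by rewrite addnC.
pose X := U ^+ k.+1 * A ^+ k.
have XE : X = A ^+ k * V ^+ k.+1.
  by rewrite /X -{1}(VjE k.+1) mulrA UjE.
have XA : X * A = U ^+ k.+1 * A ^+ k.+1 by rewrite /X -mulrA -exprSr.
have XAk : X * A ^+ k.+1 = A ^+ k by rewrite /X -mulrA -exprD UjE.
exists X; rewrite !mulmxE; apply/and3P; split; apply/eqP => //.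
- by rewrite XA XE mulrA -(mulrA (U ^+ _)) -exprD addnC UjE.
- rewrite XA XE mulrA -exprS [in RHS](exprS A) -(VjE k.+1) !mulrA.
  by rewrite -(mulrA _ A) -exprS (exprSr A (k + _)) mulrA UjE -exprSr.
Qed.

Definition drazin A : 'M[C]_n := xchoose (drazin_exists A).

Lemma drazinP A : is_drazin A (drazin A).
Proof. exact: xchooseP. Qed.

Lemma drazin_uniq A X : is_drazin A X -> X = drazin A.
Proof.
move: (drazinP A); set Y := drazin A; set k := mxindex A.
have main Z T : is_drazin A Z -> is_drazin A T ->
    A * Z = A * T * (A * Z) /\ A * Z = A * Z * (A * T).
  rewrite /is_drazin !mulmxE -/k.
  case/and3P=> /eqP ZAZ /eqP AZ _ /and3P[_ /eqP AT /eqP TAk].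
  have AZk : A * Z = A ^+ k.+1 * Z ^+ k.+1.
    rewrite -exprMn_comm //; elim: k {TAk} => // j IH.
    by rewrite exprS -IH -mulrA (mulrA Z) ZAZ.
  have ZAk : A * Z = Z ^+ k.+1 * A ^+ k.+1.
    by rewrite AZk; apply: commrX; apply/commr_sym/commrX/commr_sym.
  have AkT : A ^+ k.+1 * T = A ^+ k.
    by rewrite -TAk; apply/commr_sym/commrX/commr_sym.
  split; first by rewrite AZk mulrA -(mulrA A T) TAk -exprS.
  by rewrite ZAk AT -mulrA (mulrA _ T) AkT -exprSr.
move=> YP XP; have [_ eX] := main _ _ XP YP; have [eY _] := main _ _ YP XP.
have AXY : A * X = A * Y by rewrite eX -eY.
move: YP XP; rewrite /is_drazin !mulmxE.
case/and3P=> /eqP YAY /eqP AY _ /and3P[/eqP XAX /eqP AX _].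
by rewrite -XAX -mulrA AXY mulrA -AX AXY AY.
Qed.

(* The core-EP inverse A^cEP. *)
Definition cepinv A : 'M[C]_n :=
  drazin A *m A ^+ mxindex A *m mpinv (A ^+ mxindex A).

(* The m-weak group inverse A^{w_m}. *)
Definition wginv m A : 'M[C]_n := cepinv A ^+ m.+1 *m A ^+ m.

Definition is_wgmpinv m A Y : bool :=
  let A1 := A *m wginv m A *m A in
  [&& Y *m A *m Y == Y, A *m Y == A1 *m mpinv A & Y *m A == drazin A *m A1].

Lemma wgmpinv_exists m A : exists Y, is_wgmpinv m A Y.
Proof.
have [/eqP + /eqP + /eqP] := and3P (drazinP A).
have /and4P[/eqP + /eqP + _ _] := mpinvP (A ^+ mxindex A).
have /and4P[/eqP + _ _ _] := mpinvP A.
rewrite /is_wgmpinv /wginv /cepinv !mulmxE.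
set k := mxindex A; set B := mpinv A; set P := mpinv (A ^+ k).
set d := drazin A => ABA KPK PKP dAd Ad dAk.
have dK : d * A ^+ k = A ^+ k * d.
  by apply: commrX.
set c := d * A ^+ k * P.
have Ac : A * c = A ^+ k * P by rewrite /c !mulrA Ad -(mulrA d) -exprS dAk.
have Acc : A * (c * c) = c.
  by rewrite mulrA Ac /c dK !mulrA KPK.
have cAc : c * A * c = c.
  rewrite -mulrA Ac /c mulrA -(mulrA d).
  by rewrite -(mulrA d) KPK mulrA.
have dAc : d * A * c = c by rewrite /c !mulrA dAd.
clearbody c.
have AcX j : A ^+ j * c ^+ j.+1 = c.
  elim: j => [|j IH]; first by rewrite mul1r.
  rewrite (exprSr A) (exprS c) (exprS c j) -mulrA (mulrA A) (mulrA (A * c)).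
  by rewrite -(mulrA A c) Acc -exprS.
set W := c ^+ m.+1 * A ^+ m.
have WAW : W * A * W = W.
  rewrite /W -(mulrA _ _ A) -exprSr (exprS A) -!mulrA (mulrA (A ^+ m)) AcX.
  by rewrite exprSr -!mulrA (mulrA A) (mulrA c (A * c)) (mulrA c A) cAc.
have dAW : d * A * W = W by rewrite /W exprS !mulrA dAc.
clearbody W; exists (W * A * B); apply/and3P; split; apply/eqP.
- by rewrite -!mulrA (mulrA B A) (mulrA A (B * A)) (mulrA A B) ABA !mulrA WAW.
- by rewrite !mulrA.
- by rewrite -!mulrA (mulrA A B) ABA !mulrA dAW.
Qed.

(* The m-weak group MP inverse A^{w_m,dagger}. *)
Definition wgmpinv m A : 'M[C]_n := xchoose (wgmpinv_exists m A).

Lemma wgmpinvP m A : is_wgmpinv m A (wgmpinv m A).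
Proof. exact: xchooseP. Qed.

Lemma wgmpinv_uniq m A Y : is_wgmpinv m A Y -> Y = wgmpinv m A.
Proof.
have [/eqP ZAZ /eqP AZ /eqP ZA] := and3P (wgmpinvP m A).
case/and3P=> /eqP YAY /eqP AY /eqP YA.
by rewrite -YAY YA -ZA -mulmxA AY -AZ mulmxA ZAZ.
Qed.

End Square.
End GeneralizedInverses.

(* Main.v *)
Require Import Defs.
From mathcomp Require Import all_boot all_order all_algebra.
From mathcomp Require Import complex reals.

(** Write [K = A ^+ k], [S = K^t* *m A ^+ m.+1], [B = mpinv A] and
    [Y = wgmpinv m A].  Everything follows from the single identity
    [S *m Y = S *m B] ([mulmx_core_wgmpinv]): seen through [S], the [m]-weak
    group MP inverse cannot be told from the Moore-Penrose inverse.

    The identity holds because [A ^+ m.+1] cancels the powers of the core-EP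
    inverse [c] in [wginv m A], leaving [A *m c], which is the orthogonal
    projector [K *m mpinv K] onto the range of [K]; and [K^t*] absorbs that
    projector.  Hence [S *m wginv m A *m A = S], and [A *m Y] is by definition
    [A *m wginv m A *m A *m B].

    An inclusion of null spaces says that a matrix killed by [S] on the left is
    killed by [D] ([nullspace_sub_mul0]).  Since [S *m Y *m A = S *m B *m A = S],
    the matrix [D *m Y] solves the equation; since [S *m B *m v = 0] means
    [S *m (Y *m v) = 0], it satisfies the null space constraint.  Conversely
    [S *m B *m (A *m Y) = S *m Y = S *m B], so any admissible [X] fulfils
    [X = X *m A *m Y = D *m Y]. *)

Set Implicit Arguments.
Unset Strict Implicit.
Unset Printing Implicit Defensive.

Import Order.TTheory GRing.Theory Num.Theory.
Local Open Scope ring_scope.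
Local Open Scope complex_scope.
Local Open Scope sesquilinear_scope.

Lemma nullspace_sub_mul0 (C : numClosedFieldType) (p q n r : nat)
    (N : 'M[C]_(p, n)) (M : 'M[C]_(q, n)) (T : 'M[C]_(n, r)) :
  {subset nullspace N <= nullspace M} -> N *m T = 0 -> M *m T = 0.
Proof.
move=> sNM NT0; apply/matrixP => i j.
have : col j T \in nullspace M.
  by apply: sNM; rewrite nullspaceE colE mulmxA NT0 mul0mx.
rewrite nullspaceE colE mulmxA -colE => /eqP/matrixP/(_ i 0).
by rewrite !mxE.
Qed.

(** The projector [K *m mpinv K] is Hermitian, so this is the conjugate
    transpose of [K *m mpinv K *m K = K]. *)
Lemma trmxC_mul_mpinv (C : numClosedFieldType) (p n : nat) (K : 'M[C]_(p, n)) :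
  K^t* *m (K *m mpinv K) = K^t*.
Proof.
have /and4P[/eqP KPK _ /eqP KPs _] := mpinvP K.
by rewrite -KPs -trmxC_mul KPK.
Qed.

Section WeakGroupInverse.
Variables (C : numClosedFieldType) (n : nat) (A : 'M[C]_n).
Let K := A ^+ mxindex A.

Lemma mulmx_cepinv : A *m cepinv A = K *m mpinv K.
Proof.
have /and3P[_ /eqP Ad /eqP dAk] := drazinP A.
have AK : A *m K = A ^+ (mxindex A).+1 by rewrite exprS mulmxE.
by rewrite /cepinv -/K !mulmxA Ad -(mulmxA (drazin A)) AK dAk.
Qed.

(** The range of [cepinv A] lies in that of [K], which the projector
    [A *m cepinv A] fixes. *)
Lemma mulmx_cepinv2 : A *m cepinv A *m cepinv A = cepinv A.
Proof.
have /and3P[_ /eqP Ad _] := drazinP A.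
have /and4P[/eqP KPK _ _ _] := mpinvP K.
have dK : drazin A *m K = K *m drazin A.
  by apply: commrX; rewrite /GRing.comm -!mulmxE Ad.
by rewrite mulmx_cepinv /cepinv -/K dK !mulmxA KPK.
Qed.

(** Cancelling one [A] against two factors [cepinv A] leaves one of them, so the
    powers collapse one at a time, down to the projector. *)
Lemma expr_mul_cepinv m : A ^+ m.+1 *m cepinv A ^+ m.+1 = A *m cepinv A.
Proof.
move: (cepinv A) mulmx_cepinv2 => c Acc.
elim: m => [|m IH]; first by rewrite !expr1.
by rewrite (exprS A) (exprSr c) -!mulmxE !mulmxA -(mulmxA A) IH -mulmxA Acc.
Qed.

(** By the cancellation of powers the left factor becomes [K^t*] times the
    projector onto the range of [K], which [K^t*] absorbs; the trailing
    [A ^+ m *m A] of [wginv m A *m A] then restores [A ^+ m.+1]. *)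
Lemma mulmx_core_wginv m :
  K^t* *m A ^+ m.+1 *m (wginv m A *m A) = K^t* *m A ^+ m.+1.
Proof.
rewrite /wginv !mulmxA -(mulmxA (K^t*)) expr_mul_cepinv mulmx_cepinv.
by rewrite trmxC_mul_mpinv -mulmxA mulmxE -exprSr.
Qed.

Lemma mulmx_core_wgmpinv m :
  K^t* *m A ^+ m.+1 *m wgmpinv m A = K^t* *m A ^+ m.+1 *m mpinv A.
Proof.
have /and3P[_ /eqP AY _] := wgmpinvP m A.
(* The innermost factor of [A ^+ m.+1] is what the defining equation for
   [A *m wgmpinv m A] acts on. *)
have AmA : A ^+ m.+1 = A ^+ m *m A by rewrite mulmxE exprSr.
move: (wginv m A) AY (mulmx_core_wginv m) => W AY SWA.
by rewrite -[in RHS]SWA AmA -!mulmxA AY !mulmxA.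
Qed.

End WeakGroupInverse.

Theorem theorem6p1 (R : realType) (n q k m : nat)
    (A : 'M[R[i]]_n) (D : 'M[R[i]]_(q, n))
    (index_A : mxindex A = k) (m_gt0 : (0 < m)%N)
    (D_null : {subset nullspace ((A ^+ k)^t* *m A ^+ m.+1) <= nullspace D}) :
  unique
    (fun X : 'M[R[i]]_(q, n) =>
       X *m A = D /\
       {subset nullspace ((A ^+ k)^t* *m A ^+ m.+1 *m mpinv A) <= nullspace X})
    (D *m wgmpinv m A).
Proof.
move: D_null; rewrite -index_A; set S := _ *m A ^+ m.+1 => sSD.
set B := mpinv A; set Y := wgmpinv m A.
have SY : S *m Y = S *m B by exact: mulmx_core_wgmpinv.
have SBA : S *m B *m A = S.
  have /and4P[/eqP ABA _ _ _] := mpinvP A.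
  by rewrite /S exprSr -mulmxE -!mulmxA (mulmxA A) ABA.
split; first split.
- apply/eqP; rewrite -subr_eq0 -mulmxA -{2}(mulmx1 D) -mulmxBr; apply/eqP.
  apply: nullspace_sub_mul0 sSD _.
  by rewrite mulmxBr mulmx1 mulmxA SY SBA subrr.
- move=> v; rewrite !nullspaceE -SY -!mulmxA (mulmxA _ _ (Y *m v)) -/S => SYv.
  exact: sSD.
- move=> X [<- sX]; apply/eqP; rewrite eq_sym -subr_eq0.
  rewrite -mulmxA -{1}(mulmx1 X) -mulmxBr; apply/eqP.
  apply: nullspace_sub_mul0 sX _.
  by rewrite mulmxBr mulmx1 mulmxA SBA SY subrr.
Qed.
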